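(* For every $k\ge 2$ and every $k$-partite $k$-graph $F$, we have $F\in\mathbf{FACTOR}_k^{\mathrm{edge},1}$.
   Context: A $k$-graph $H=(V(H),E(H))$ has edge set $E(H)\subseteq\binom{V(H)}{k}$; $\delta_1(H)$ is the minimum number of edges containing a vertex. A $k$-graph $F$ is $k$-partite if $V(F)$ can be partitioned into $k$ classes such that every edge meets each class in exactly one vertex. An $F$-factor in $H$ is a set of vertex-disjoint copies of $F$ in $H$ covering $V(H)$. An $(n,p,\mu,\mathrm{edge})$ $k$-graph is a $k$-graph $H$ on a vertex set $V$ with $|V|=n$ such that for all $X\subseteq V$ and all $Y\subseteq V^{k-1}$, the number of pairs $(x,(y_1,\dots,y_{k-1}))\in X\times Y$ with $\{x,y_1,\dots,y_{k-1}\}\in E(H)$ is at least $p|X||Y|-\mu n^k$. $\mathbf{FACTOR}_k^{\mathrm{edge},1}$ is the class of $k$-graphs $F$ such that for all $0<p,\alpha<1$ there exist $n_0\in\mathbb{N}$ and $\mu>0$ such that every $(n,p,\mu,\mathrm{edge})$ $k$-graph $H$ with $\delta_1(H)\ge\alpha n^{k-1}$, $n\ge n_0$ and $v(F)\mid n$ has an $F$-factor. *)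

(* Defs.v *)
From HB Require Import structures.
From mathcomp Require Import all_boot all_order all_algebra.
From mathcomp Require Import reals.
Set Implicit Arguments. Unset Strict Implicit. Unset Printing Implicit Defensive.
Import Order.TTheory GRing.Theory Num.Theory.
Local Open Scope ring_scope.

Definition is_kgraph (k : nat) (V : finType) (E : {set {set V}}) : Prop :=
  forall e, e \in E -> #|e| = k.

Definition vdeg (V : finType) (E : {set {set V}}) (v : V) : nat :=
  #|[set e in E | v \in e]|.

Definition min_codeg1_ge (R : realType) (k : nat) (V : finType)
  (E : {set {set V}}) (a : R) : Prop :=
  forall v : V, (vdeg E v)%:R >= a * (#|V|%:R) ^+ k.-1.

Definition kpartite (k : nat) (W : finType) (EF : {set {set W}}) : Prop :=
  exists c : W -> 'I_k,
    forall e, e \in EF -> forall i : 'I_k, #|[set x in e | c x == i]| = 1%N.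

Definition copy_on (W V : finType) (EF : {set {set W}}) (EH : {set {set V}})
  (B : {set V}) : Prop :=
  exists phi : W -> V,
    injective phi /\ phi @: [set: W] = B /\ forall e, e \in EF -> phi @: e \in EH.

Definition has_factor (W V : finType) (EF : {set {set W}}) (EH : {set {set V}})
  : Prop :=
  exists P : {set {set V}}, partition P [set: V] /\
    forall B, B \in P -> copy_on EF EH B.

Definition tup_edge (k : nat) (V : finType) (x : V) (y : {ffun 'I_k.-1 -> V})
  : {set V} := x |: [set y i | i : 'I_k.-1].

Definition edge_dense (R : realType) (k : nat) (V : finType)
  (E : {set {set V}}) (p mu : R) : Prop :=
  forall (X : {set V}) (Y : {set {ffun 'I_k.-1 -> V}}),
    (#|[set xy in setX X Y | tup_edge xy.1 xy.2 \in E]|)%:R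
      >= p * (#|X|)%:R * (#|Y|)%:R - mu * (#|V|%:R) ^+ k.

Definition in_FACTOR_edge1 (R : realType) (k : nat) (W : finType)
  (EF : {set {set W}}) : Prop :=
  forall p a : R, 0 < p < 1 -> 0 < a < 1 ->
    exists n0 : nat, exists2 mu : R, 0 < mu &
      forall (V : finType) (EH : {set {set V}}),
        is_kgraph k EH -> edge_dense k EH p mu -> min_codeg1_ge k EH a ->
        (n0 <= #|V|)%N -> (#|W| %| #|V|)%N -> has_factor EF EH.

(* Main.v *)
Require Import Defs.
From mathcomp Require Import all_boot all_order all_algebra.
From mathcomp Require Import reals.
From mathcomp Require Import zify ring lra.
Set Implicit Arguments. Unset Strict Implicit. Unset Printing Implicit Defensive.
Import Order.TTheory GRing.Theory Num.Theory.
Local Open Scope ring_scope.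

(** The proof is by absorption.  Write f = |W|, n = |V|.  Duplicating vertices one
at a time with Cauchy-Schwarz shows that a positive density of ordered edges (or
of ordered edges whose link part lies in a prescribed dense set) yields a positive
density of homomorphisms from F.  Applying the edge-density hypothesis to the link
of a vertex q shows that all but a small fraction of the vertices d share a
positive proportion of the link of q, so q and d can play the role of a fixed
vertex w0 of F in many common partial copies of F.

Hence for every f-tuple q a positive proportion of the maps option W * W -> V are
absorbers for q: a copy D of F, and for each w a copy of F - w0 that is completed
both by D w and by q w.  Without q, complete the partial copies by D; with q,
complete them by q and use D as one more copy.

A greedy choice controlled by the potential sum_q 2^-(number of absorbers chosen
for q) produces linearly many disjoint absorbers such that every q has more than
n %/ K of them.  Every set of more than n %/ K vertices contains a copy of F, so
the remaining vertices are tiled greedily up to at most n %/ K of them, and these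
are absorbed f at a time. *)

(** * Counting maps by resampling one coordinate *)

Definition upd (M V : finType) (z : {ffun M -> V}) (a : M) (x : V) : {ffun M -> V} :=
  [ffun j => if j == a then x else z j].

Lemma card_sum1 (R : realFieldType) (T : finType) (A : {set T}) :
  #|A|%:R = \sum_(t : T) (t \in A)%:R :> R.
Proof. by rewrite -sum1_card natr_sum big_mkcond; apply: eq_bigr => t _; case: (t \in A). Qed.

(** Exchanging the value [z a] with [x] is an involution on pairs [(z, x)] that turns [upd z a x]
    into [z]; afterwards the second component is free and gives the factor |V|. *)
Lemma sum_upd (R : realFieldType) (M V : finType) (a : M) (g : {ffun M -> V} -> R) :
  \sum_z \sum_x g (upd z a x) = #|V|%:R * \sum_z g z.
Proof.
rewrite pair_bigA /=.
pose h (u : {ffun M -> V} * V) := (upd u.1 a u.2, u.1 a).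
have hK : involutive h.
  move=> [z x]; rewrite /h /=; congr pair; last by rewrite ffunE eqxx.
  by apply/ffunP=> j; rewrite !ffunE; case: eqP => [->|].
rewrite (reindex_inj (inv_inj hK)) /=.
rewrite -(pair_bigA _ (fun z x => g (upd (upd z a x) a (z a)))) /=.
under eq_bigr => z _.
  under eq_bigr => x _.
    have -> : upd (upd z a x) a (z a) = z.
      by apply/ffunP=> j; rewrite !ffunE; case: eqP => [->|].
    over.
  rewrite sumr_const; over.
by rewrite mulr_sumr; apply: eq_bigr => z _; rewrite mulr_natl.
Qed.

Lemma card_coord (R : realFieldType) (M V : finType) (a : M) (X : {set V}) :
  #|V|%:R * #|[set z : {ffun M -> V} | z a \in X]|%:R
    = #|X|%:R * #|V|%:R ^+ #|M| :> R.
Proof.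
rewrite card_sum1 -(sum_upd a).
transitivity (\sum_(z : {ffun M -> V}) (#|X|%:R : R)).
  apply: eq_bigr => z _; rewrite card_sum1; apply: eq_bigr => x _.
  by rewrite inE ffunE eqxx.
by rewrite sumr_const card_ffun -[LHS]mulr_natr natrX.
Qed.

Lemma card_coord_eq (R : realFieldType) (M V : finType) (a b : M) : a != b ->
  #|V|%:R * #|[set z : {ffun M -> V} | z a == z b]|%:R = #|V|%:R ^+ #|M| :> R.
Proof.
move=> ab; rewrite card_sum1 -(sum_upd a).
transitivity (\sum_(z : {ffun M -> V}) (1 : R)).
  apply: eq_bigr => z _.
  transitivity (#|[set z b]|%:R : R); last by rewrite cards1.
  rewrite card_sum1; apply: eq_bigr => x _.
  by rewrite !inE !ffunE eqxx eq_sym (negbTE (_ : b != a)) // eq_sym // eq_sym.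
by rewrite sumr_const card_ffun natrX.
Qed.

(* Cauchy-Schwarz in the linearised form deg^2 >= 2 d n deg - (d n)^2, where deg z
   counts the values of coordinate a that keep z in F; coordinate b, which F
   ignores, stores the duplicate. *)
Lemma card_dup (R : realFieldType) (M V : finType) (a b : M)
    (F : {set {ffun M -> V}}) (d : R) :
  a != b -> (forall z x, (upd z b x \in F) = (z \in F)) -> (0 < #|V|)%N ->
  0 <= d -> d * #|V|%:R ^+ #|M| <= #|F|%:R ->
  d ^+ 2 * #|V|%:R ^+ #|M|
    <= #|[set z in F | upd z a (z b) \in F]|%:R.
Proof.
move=> ab Fb V0 d0 dF.
set n : R := #|V|%:R; have n0 : 0 < n by rewrite ltr0n.
set F' := [set z in F | _].
pose deg (z : {ffun M -> V}) : R := \sum_x (upd z a x \in F)%:R.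
have sdeg : \sum_z deg z = n * #|F|%:R.
  by rewrite /deg (sum_upd a (fun z => (z \in F)%:R)) card_sum1.
(* Resampling coordinate [a] to x and coordinate [b] to y puts the map in [F'] exactly when both x
   and y, placed at [a], keep z in [F]; summing over x and y gives the square of the degree. *)
have sdeg2 : \sum_z deg z ^+ 2 = n ^+ 2 * #|F'|%:R.
  rewrite (card_sum1 _ F') expr2 -mulrA -(sum_upd b) -(sum_upd a).
  apply: eq_bigr => z _; rewrite expr2 {1}/deg mulr_suml; apply: eq_bigr => x _.
  rewrite /deg mulr_sumr; apply: eq_bigr => y _.
  rewrite inE Fb !ffunE eqxx.
  have -> : upd (upd (upd z a x) b y) a y = upd (upd z a y) b y.
    by apply/ffunP=> j; rewrite !ffunE; case: eqP => // ->; rewrite if_same.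
  by rewrite Fb; do 2!case: (_ \in F); rewrite ?mulr1 ?mulr0.
have : \sum_z (2 * (d * n) * deg z - (d * n) ^+ 2) <= \sum_z deg z ^+ 2.
  apply: ler_sum => z _; have := sqr_ge0 (deg z - d * n); nra.
rewrite sdeg2 sumrB -mulr_sumr sdeg sumr_const card_ffun -(mulr_natr ((d * n) ^+ 2)) natrX -/n => H.
have n2 : 0 < n ^+ 2 by rewrite exprn_gt0.
rewrite -(ler_pM2l n2); apply: le_trans H.
have := ler_wpM2l (ltW n2) (ler_wpM2l d0 dF); rewrite -/n.
set N := n ^+ #|M|; nra.
Qed.

(** * Homomorphisms from blow-ups, obtained by repeated duplication *)

(* The second conjunct matters only if c misses a colour: there is then no section,
   and the first one is void. *)
Definition blowup_homs (C W V : finType) (c : W -> C) (G : {set {ffun C -> V}}) :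
    {set {ffun W -> V}} :=
  [set phi : {ffun W -> V} |
    [forall s : {ffun C -> W}, [forall i, c (s i) == i] ==>
       ([ffun i => phi (s i)] \in G)]
    && [forall w, [exists g in G, g (c w) == phi w]]].

Definition join_ffun (C W V : finType) (u : {ffun C -> V} * {ffun W -> V}) :
    {ffun C + W -> V} :=
  [ffun j => match j with inl i => u.1 i | inr w => u.2 w end].

Lemma join_ffun_inj (C W V : finType) : injective (@join_ffun C W V).
Proof.
move=> [g f] [g' f'] /ffunP E; congr pair; apply/ffunP => x.
  by have := E (inl x); rewrite !ffunE.
by have := E (inr x); rewrite !ffunE.
Qed.

(* Coordinates inl i hold an edge, and inr w with w \in l a duplicate of the vertex
   of colour c w; coordinates inr w with w \notin l are unconstrained. *)
Definition partial_blowup (C W V : finType) (c : W -> C) (G : {set {ffun C -> V}})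
    (l : seq W) : {set {ffun C + W -> V}} :=
  [set z : {ffun C + W -> V} |
    [forall s : {ffun C -> C + W},
       [forall i, match s i with inl j => j == i | inr w => (w \in l) && (c w == i) end]
       ==> ([ffun i => z (s i)] \in G)]].

(** If a section uses the new duplicate [w], redirect it to the edge coordinate of colour [c w],
    which the update has overwritten with the value at [w]. A section that does not use [w] is
    covered by the condition for [l]. *)
Lemma partial_blowup_cons (C W V : finType) (c : W -> C) (G : {set {ffun C -> V}})
    (w : W) (l : seq W) :
  [set z in partial_blowup c G l | upd z (inl (c w)) (z (inr w)) \in partial_blowup c G l]
    \subset partial_blowup c G (w :: l).
Proof.
apply/subsetP => z; rewrite !inE => /andP[/forallP H1 /forallP H2].
apply/forallP => s; apply/implyP => /forallP Hs.
have [sw|sw] := eqVneq (s (c w)) (inr w).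
- pose s' := [ffun i => if i == c w then inl i else s i].
  suff HG : [ffun i => upd z (inl (c w)) (z (inr w)) (s' i)] \in G.
    move: HG; congr (_ \in G); apply/ffunP => i; rewrite !ffunE.
    case: (eqVneq i (c w)) => [->|ic]; first by rewrite eqxx sw.
    have := Hs i; case: (s i) => [j /eqP ->|v //].
    by rewrite (inj_eq inl_inj) (negbTE ic).
  apply: (implyP (H2 s')); apply/forallP => i; rewrite ffunE; case: (eqVneq i (c w)) => [->|ic]; first exact: eqxx.
    have := Hs i; case: (s i) => // v; rewrite inE => /andP[/orP[/eqP ->|->] //].
    by rewrite eq_sym (negbTE ic).
- have /implyP := H1 s; apply; apply/forallP => i; have := Hs i.
  case E: (s i) => [j|v]; rewrite ?inE // => /andP[/orP[/eqP vw|->] // /eqP ci].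
  by move: sw; rewrite -vw ci E eqxx.
Qed.

(** Each duplication squares the density, by [card_dup]; hence the exponent 2 ^ [size l]. *)
Lemma card_partial_blowup (R : realFieldType) (C W V : finType) (c : W -> C)
    (G : {set {ffun C -> V}}) (d : R) (l : seq W) :
  (0 < #|V|)%N -> 0 <= d -> d * #|V|%:R ^+ #|C| <= #|G|%:R -> uniq l ->
  d ^+ (2 ^ size l) * #|V|%:R ^+ #|{: C + W}| <= #|partial_blowup c G l|%:R.
Proof.
move=> V0 d0 dG; elim: l => [_|w l IH /= /andP[wl ul]].
  rewrite expr1 card_sum exprD mulrA.
  have HX : (#|G| * #|V| ^ #|W|)%:R <= #|partial_blowup c G [::]|%:R :> R.
    rewrite ler_nat.
    have -> : (#|G| * #|V| ^ #|W|)%N = #|setX G [set: {ffun W -> V}]|.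
      by rewrite cardsX cardsT card_ffun.
    rewrite -(card_imset _ (@join_ffun_inj C W V)); apply: subset_leq_card.
    apply/subsetP => _ /imsetP[[g f] /setXP[gG _] ->]; rewrite inE.
    apply/forallP => s; apply/implyP => /forallP Hs.
    rewrite (_ : finfun _ = g) //; apply/ffunP => i; rewrite !ffunE.
    by have := Hs i; case: (s i) => [j /eqP ->|].
  apply: le_trans HX; rewrite natrM natrX ler_wpM2r // exprn_ge0 //.
have {}IH := IH ul.
rewrite expnS mulnC exprM.
have := card_dup (a := inl (c w)) (b := inr w) _ _ V0 (exprn_ge0 _ d0) IH.
move=> /(_ isT) H; apply: le_trans (H _) _; last first.
  by rewrite ler_nat; apply/subset_leq_card/partial_blowup_cons.
move=> z x; rewrite !inE; apply: eq_forallb => s.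
case Hs: [forall i, _] => //=; congr (_ \in G); apply/ffunP => i; rewrite !ffunE.
have := forallP Hs i; case: (s i) => // v /andP[vl _].
by case: eqP => // -[vw]; move: wl; rewrite -vw vl.
Qed.

(** Duplicate every vertex of [W], then forget the edge coordinates, which account for a factor of
    at most |V| ^ |C|. *)
Lemma card_blowup_homs (R : realFieldType) (C W V : finType) (c : W -> C)
    (G : {set {ffun C -> V}}) (d : R) :
  (0 < #|V|)%N -> 0 <= d -> d * #|V|%:R ^+ #|C| <= #|G|%:R ->
  d ^+ (2 ^ #|W|) * #|V|%:R ^+ #|W| <= #|blowup_homs c G|%:R.
Proof.
move=> V0 d0 dG.
have := card_partial_blowup c V0 d0 dG (enum_uniq W).
rewrite -cardE card_sum exprD mulrCA mulrC => H.
have nC : 0 < (#|V|%:R : R) ^+ #|C| by rewrite exprn_gt0 // ltr0n.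
rewrite -(ler_pM2r nC); apply: le_trans H _.
rewrite -natrX -natrM ler_nat mulnC.
have -> : (#|V| ^ #|C| * #|blowup_homs c G|)%N
    = #|setX [set: {ffun C -> V}] (blowup_homs c G)|.
  by rewrite cardsX cardsT card_ffun.
rewrite -(card_imset _ (@join_ffun_inj C W V)); apply: subset_leq_card.
apply/subsetP => z; rewrite inE => /forallP Hz.
pose g := [ffun i => z (inl i)]; pose f := [ffun w => z (inr w)].
apply/imsetP; exists (g, f); last by apply/ffunP => -[i|w]; rewrite !ffunE.
rewrite !inE /=; apply/andP; split; apply/forallP.
  move=> s; apply/implyP => /forallP Hs.
  suff HG : [ffun i => z ([ffun i => inr (s i)] i)] \in G.
    by move: HG; congr (_ \in G); apply/ffunP => i; rewrite !ffunE.
  apply: (implyP (Hz _)); apply/forallP => i; rewrite ffunE mem_enum /=; exact: Hs.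
move=> w; apply/existsP.
(* The section that takes [w] at its own colour and edge coordinates elsewhere yields an element of
   [G] through the image of [w]. *)
pose s : {ffun C -> C + W} := [ffun i => if i == c w then inr w else inl i].
exists [ffun i => z (s i)]; rewrite !ffunE eqxx !eqxx andbT.
have /implyP := Hz s; apply; apply/forallP => i; rewrite ffunE.
by case: eqP => [->|_]; rewrite ?mem_enum ?eqxx.
Qed.

(** * Homomorphism counts in edge-dense k-graphs *)

Definition ffun_hom (W V : finType) (EF : {set {set W}}) (EH : {set {set V}})
    (phi : {ffun W -> V}) : bool :=
  [forall e in EF, phi @: e \in EH].

Definition kcoloring (k : nat) (W : finType) (EF : {set {set W}}) (c : W -> 'I_k) : Prop :=
  forall e, e \in EF -> forall i : 'I_k, #|[set x in e | c x == i]| = 1%N.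

Definition ordered_edges (k : nat) (V : finType) (EH : {set {set V}}) :
    {set {ffun 'I_k -> V}} :=
  [set g : {ffun 'I_k -> V} | [set g i | i : 'I_k] \in EH].

Definition ordered_link (k : nat) (V : finType) (EH : {set {set V}}) (v : V) :
    {set {ffun 'I_k.-1 -> V}} :=
  [set y | tup_edge v y \in EH].

Lemma kcoloring_section (k : nat) (W : finType) (EF : {set {set W}}) (c : W -> 'I_k)
    (e : {set W}) : kcoloring EF c -> e \in EF ->
  exists s : {ffun 'I_k -> W}, (forall i, c (s i) = i) /\ e = [set s i | i : 'I_k].
Proof.
move=> Hc eF.
have /fin_all_exists[s Hs] : forall i, exists x, [set x in e | c x == i] = [set x].
  by move=> i; apply/cards1P; rewrite Hc.
have Hs1 i : (s i \in e) && (c (s i) == i) by have := set11 (s i); rewrite -Hs inE.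
exists [ffun i => s i]; split=> [i|]; first by rewrite ffunE; case/andP: (Hs1 i) => _ /eqP.
apply/setP => x; apply/idP/imsetP => [xe|[i _ ->]]; last first.
  by rewrite ffunE; case/andP: (Hs1 i).
exists (c x) => //; rewrite ffunE; apply/set1P; rewrite -Hs inE xe eqxx //.
Qed.

Lemma blowup_hom (k : nat) (W V : finType) (EF : {set {set W}}) (EH : {set {set V}})
    (c : W -> 'I_k) (G : {set {ffun 'I_k -> V}}) (phi : {ffun W -> V}) :
  kcoloring EF c -> G \subset ordered_edges k EH -> phi \in blowup_homs c G ->
  ffun_hom EF EH phi.
Proof.
move=> Hc /subsetP GE; rewrite inE => /andP[/forallP H _].
apply/forall_inP => e eF; have [s [cs ->]] := kcoloring_section Hc eF.
have HG : [ffun i => phi (s i)] \in G.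
  by move/implyP: (H s); apply; apply/forallP => i; rewrite cs.
have := GE _ HG; rewrite inE -imset_comp; congr (_ \in EH); apply: eq_imset => i; by rewrite ffunE.
Qed.

(** Each edge of F is the image of a section of [c]. If the edge contains [w0], moving [w0] changes
    exactly the coordinate [c w0] of the corresponding tuple; otherwise it changes nothing. *)
Lemma blowup_hom_upd (k : nat) (W V : finType) (EF : {set {set W}}) (EH : {set {set V}})
    (c : W -> 'I_k) (G : {set {ffun 'I_k -> V}}) (phi : {ffun W -> V}) (w0 : W) (x : V) :
  kcoloring EF c -> G \subset ordered_edges k EH ->
  (forall g, g \in G -> upd g (c w0) x \in ordered_edges k EH) ->
  phi \in blowup_homs c G -> ffun_hom EF EH (upd phi w0 x).
Proof.
move=> Hc /subsetP GE Gx; rewrite inE => /andP[/forallP H _].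
apply/forall_inP => e eF; have [s [cs ->]] := kcoloring_section Hc eF.
have HG : [ffun i => phi (s i)] \in G.
  by move/implyP: (H s); apply; apply/forallP => i; rewrite cs.
rewrite -imset_comp; have [sw|sw] := eqVneq (s (c w0)) w0.
  have := Gx _ HG; rewrite inE; congr (_ \in EH); apply: eq_imset => i.
  rewrite /= !ffunE; suff -> : (s i == w0) = (i == c w0) by [].
  by apply/eqP/eqP => [<-|-> //]; rewrite cs.
have := GE _ HG; rewrite inE; congr (_ \in EH); apply: eq_imset => i.
rewrite /= !ffunE; case: eqP => // si.
by move: sw; rewrite -si cs eqxx.
Qed.

(** Translates the pairs of [edge_dense] into k-tuples. The position of the distinguished vertex is
    a parameter because it has to be the colour of [w0] in [card_link_switch]. *)
Definition insert_ffun (k : nat) (V : finType) (i0 : 'I_k) (u : V * {ffun 'I_k.-1 -> V}) :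
    {ffun 'I_k -> V} :=
  [ffun i => if unlift i0 i is Some j then u.2 j else u.1].

Lemma insert_ffun_inj (k : nat) (V : finType) (i0 : 'I_k) : injective (@insert_ffun k V i0).
Proof.
move=> [x y] [x' y'] /ffunP E; congr pair; last apply/ffunP => j.
  by have := E i0; rewrite !ffunE unlift_none.
by have := E (lift i0 j); rewrite !ffunE liftK.
Qed.

Lemma imset_insert_ffun (k : nat) (V : finType) (i0 : 'I_k) (x : V)
    (y : {ffun 'I_k.-1 -> V}) :
  [set insert_ffun i0 (x, y) i | i : 'I_k] = tup_edge x y.
Proof.
apply/setP => v; rewrite in_setU1; apply/imsetP/idP.
  case=> i _ ->; rewrite ffunE; case: unliftP => [j _|_] /=; last by rewrite eqxx.
  by rewrite imset_f ?orbT.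
case/orP => [/eqP ->|/imsetP[j _ ->]].
  by exists i0; rewrite // ffunE unlift_none.
by exists (lift i0 j); rewrite // ffunE liftK.
Qed.

Lemma upd_insert_ffun (k : nat) (V : finType) (i0 : 'I_k) (x x' : V)
    (y : {ffun 'I_k.-1 -> V}) :
  upd (insert_ffun i0 (x, y)) i0 x' = insert_ffun i0 (x', y).
Proof.
by apply/ffunP => i; rewrite !ffunE; case: unliftP => [j ->|->];
  rewrite ?eqxx // eq_sym (negbTE (neq_lift _ _)).
Qed.

Lemma edge_dense_ordered (R : realType) (k : nat) (V : finType) (EH : {set {set V}})
    (p mu : R) (i0 : 'I_k) (X : {set V}) (Y : {set {ffun 'I_k.-1 -> V}}) :
  edge_dense k EH p mu ->
  p * #|X|%:R * #|Y|%:R - mu * #|V|%:R ^+ k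
    <= #|[set g in ordered_edges k EH | (g \in insert_ffun i0 @: setX X Y)]|%:R.
Proof.
move=> H; apply: le_trans (H X Y) _; rewrite ler_nat.
rewrite -(card_imset _ (@insert_ffun_inj k V i0)); apply: subset_leq_card.
apply/subsetP => g /imsetP[[x y]]; rewrite !inE /= => /andP[/andP[xX yY] xy] ->.
rewrite imset_insert_ffun xy /=; apply: imset_f; by rewrite inE /= xX yY.
Qed.

Lemma vdeg_le_link (k : nat) (V : finType) (EH : {set {set V}}) (v : V) :
  is_kgraph k EH -> (vdeg EH v <= #|ordered_link k EH v|)%N.
Proof.
move=> kE; apply: leq_trans (leq_imset_card (fun y : {ffun 'I_k.-1 -> V} => tup_edge v y) _).
apply: subset_leq_card; apply/subsetP => e; rewrite inE => /andP[eE ve].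
have ce : #|e :\ v| = k.-1 by have := kE _ eE; rewrite (cardsD1 v) ve => <-.
pose y := [ffun i : 'I_k.-1 => enum_val (cast_ord (esym ce) i)].
have ey : tup_edge v y = e.
  rewrite /tup_edge -[RHS](setD1K ve); congr (_ |: _); apply/setP => x.
  apply/imsetP/idP => [[i _ ->]|xe]; first by rewrite ffunE enum_valP.
  exists (cast_ord ce (enum_rank_in xe x)) => //.
  by rewrite ffunE cast_ord_comp cast_ord_id enum_rankK_in.
by apply/imsetP; exists y; rewrite ?inE ey.
Qed.

Definition poor_partners (R : realType) (k : nat) (V : finType) (EH : {set {set V}})
    (p : R) (q : V) : {set V} :=
  [set x | #|ordered_link k EH x :&: ordered_link k EH q|%:R
             < p / 2 * #|ordered_link k EH q|%:R].

(** Take X to be the poor partners and Y the link of [q]. Poorness gives at most (p/2)|X||Y| edges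
    between them, density at least p|X||Y| - mu n^k, so (p/2)|X||Y| is at most mu n^k, while |Y| is
    at least a n^(k-1). *)
Lemma card_poor_partners (R : realType) (k : nat) (V : finType) (EH : {set {set V}})
    (p a mu : R) (q : V) :
  (0 < k)%N -> (0 < #|V|)%N -> 0 < p -> 0 < a -> edge_dense k EH p mu ->
  a * #|V|%:R ^+ k.-1 <= #|ordered_link k EH q|%:R ->
  #|poor_partners k EH p q|%:R <= 2 * mu / (p * a) * #|V|%:R.
Proof.
move=> k0 V0 p0 a0 dE aq.
set X := poor_partners _ _ _ _; set Y := ordered_link k EH q in aq *.
have n0 : 0 < #|V|%:R :> R by rewrite ltr0n.
have H1 : #|[set xy in setX X Y | tup_edge xy.1 xy.2 \in EH]|%:R
    <= #|X|%:R * (p / 2 * #|Y|%:R).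
  rewrite card_sum1 (eq_bigr (fun u =>
    [&& u.1 \in X, u.2 \in Y & tup_edge u.1 u.2 \in EH]%:R)); last first.
    by move=> [x y] _; rewrite in_set in_setX andbA.
  rewrite -(pair_bigA _ (fun x y => [&& x \in X, y \in Y & tup_edge x y \in EH]%:R)) /=.
  rewrite (bigID (mem X)) /= [X in _ + X]big1 ?addr0; last first.
    by move=> x /negbTE xX; apply: big1 => y _; rewrite xX.
  rewrite mulr_natl -sumr_const; apply: ler_sum => x xX.
  have xp : #|ordered_link k EH x :&: Y|%:R < p / 2 * #|Y|%:R.
    by move: xX; rewrite /X inE.
  apply: le_trans (ltW xp).
  rewrite card_sum1; apply: ler_sum => y _; rewrite xX in_setI !inE ler_nat.
  by rewrite /= andbC.
have nk : #|V|%:R ^+ k = #|V|%:R * #|V|%:R ^+ k.-1 :> R by rewrite -exprS prednK.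
have := le_trans (dE X Y) H1; rewrite nk => H2.
have Nn : 0 < #|V|%:R ^+ k.-1 :> R by rewrite exprn_gt0.
rewrite mulrAC ler_pdivlMr ?mulr_gt0 // -(ler_pM2r Nn).
have X0 : 0 <= #|X|%:R :> R by [].
have := ler_wpM2l (mulr_ge0 X0 (ltW p0)) aq.
set N := _ ^+ _ in H2 *; nra.
Qed.

(** Density on X and X^(k-1) gives p|X|^k - mu n^k ordered edges inside X, and the bound on [mu]
    leaves half of the main term. The second conjunct of [blowup_homs] keeps even isolated vertices
    of F inside X. *)
Lemma card_hom_within (R : realType) (k : nat) (W V : finType) (EF : {set {set W}})
    (EH : {set {set V}}) (c : W -> 'I_k) (p mu eta : R) (X : {set V}) :
  (0 < k)%N -> (0 < #|W|)%N -> (0 < #|V|)%N -> kcoloring EF c ->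
  edge_dense k EH p mu -> 0 <= p -> 0 <= eta ->
  eta * #|V|%:R <= #|X|%:R -> mu <= p * eta ^+ k / 2 ->
  (p * eta ^+ k / 2) ^+ (2 ^ #|W|) * #|V|%:R ^+ #|W|
    <= #|[set phi : {ffun W -> V} | ffun_hom EF EH phi && [forall w, phi w \in X]]|%:R.
Proof.
move=> k0 W0 V0 Hc dE p0 e0 eX Hmu.
have /card_gt0P[w1 _] := W0; set i0 := c w1.
set n : R := #|V|%:R; have n0 : 0 < n by rewrite ltr0n.
pose Y := [set y : {ffun 'I_k.-1 -> V} | y \in ffun_on (mem X)].
have cY : #|Y| = (#|X| ^ k.-1)%N.
  by rewrite cardsE card_ffun_on card_ord.
pose G := [set g in ordered_edges k EH | g \in insert_ffun i0 @: setX X Y].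
have dG : p * eta ^+ k / 2 * n ^+ #|'I_k| <= #|G|%:R.
  apply: le_trans (edge_dense_ordered i0 X Y dE); rewrite card_ord cY natrX.
  rewrite -[p * #|X|%:R * _]mulrA -exprS prednK //.
  have : (eta * n) ^+ k <= #|X|%:R ^+ k by rewrite lerXn2r // ?nnegrE ?mulr_ge0 // ltW.
  rewrite exprMn -/n => /(ler_wpM2l p0).
  have := ler_wpM2r (ltW (exprn_gt0 k n0)) Hmu.
  set N := n ^+ k; set E := eta ^+ k; set Z := _ ^+ k => H1 H2; nra.
have d0 : 0 <= p * eta ^+ k / 2 by rewrite divr_ge0 // mulr_ge0 // exprn_ge0.
apply: le_trans (card_blowup_homs c V0 d0 dG) _.
rewrite ler_nat; apply: subset_leq_card; apply/subsetP => phi Hphi; rewrite inE.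
rewrite (blowup_hom Hc _ Hphi) /=; last by apply/subsetP => g; rewrite inE => /andP[].
move: Hphi; rewrite inE => /andP[_ /forallP H]; apply/forallP => w.
have /existsP[g /andP[]] := H w; rewrite inE => /andP[_ /imsetP[[x y]]].
rewrite in_setX inE => /andP[xX /ffun_onP yX] -> /eqP <-.
rewrite ffunE; case: unlift => [j|] //=; exact: yX.
Qed.

Lemma card_hom_avoid (R : realType) (W V : finType) (P : {set {ffun W -> V}})
    (B : W -> {set V}) (d e : R) : (0 < #|V|)%N ->
  d * #|V|%:R ^+ #|W| <= #|P|%:R -> (forall w, #|B w|%:R <= e * #|V|%:R) ->
  (d - #|W|%:R * e) * #|V|%:R ^+ #|W|
    <= #|[set phi in P | [forall w, phi w \notin B w]]|%:R.
Proof.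
move=> V0 dP Be.
set n : R := #|V|%:R; have n0 : 0 < n by rewrite ltr0n.
have H : #|P|%:R <= #|[set phi in P | [forall w, phi w \notin B w]]|%:R
    + \sum_w #|[set phi : {ffun W -> V} | phi w \in B w]|%:R :> R.
  under [X in _ + X]eq_bigr do rewrite card_sum1.
  rewrite !card_sum1 exchange_big -big_split /=; apply: ler_sum => phi _.
  rewrite inE; case: (phi \in P); last by rewrite add0r sumr_ge0.
  case: forallP => /= Hf; first by rewrite lerDl sumr_ge0.
  have [w Hw] : exists w, phi w \in B w.
    by apply/existsP; apply: contra_notT Hf; rewrite negb_exists => /forallP.
  by rewrite add0r (bigD1 w) //= inE Hw lerDl sumr_ge0.
have : \sum_w #|[set phi : {ffun W -> V} | phi w \in B w]|%:R <= \sum_(w : W) e * n ^+ #|W|.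
  apply: ler_sum => w _; rewrite -(ler_pM2l n0) card_coord mulrCA mulrA.
  by rewrite ler_pM2r ?exprn_gt0 // mulrC Be.
rewrite sumr_const -[_ *+ _]mulr_natl; move: dP H; rewrite -/n.
set N := n ^+ _; set s := \sum__ _; lra.
Qed.

(** Blow up the ordered edges whose part off colour [c w0] lies in both links: in such a tuple the
    vertex of colour [c w0] can be replaced by [q] or by [x]. The common link has at least (p a / 2)
    n^(k-1) members, so these edges number at least (p^2 a / 2 - mu) n^k. *)
Lemma card_link_switch (R : realType) (k : nat) (W V : finType) (EF : {set {set W}})
    (EH : {set {set V}}) (c : W -> 'I_k) (p a mu : R) (w0 : W) (q x : V) :
  (0 < k)%N -> (0 < #|V|)%N -> kcoloring EF c -> edge_dense k EH p mu ->
  0 < p -> 0 < a -> mu <= p ^+ 2 * a / 4 ->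
  a * #|V|%:R ^+ k.-1 <= #|ordered_link k EH q|%:R ->
  x \notin poor_partners k EH p q ->
  (p ^+ 2 * a / 4) ^+ (2 ^ #|W|) * #|V|%:R ^+ #|W|
    <= #|[set phi : {ffun W -> V} |
          ffun_hom EF EH (upd phi w0 q) && ffun_hom EF EH (upd phi w0 x)]|%:R.
Proof.
move=> k0 V0 Hc dE p0 a0 Hmu aq; rewrite inE -leNgt => xq.
set n : R := #|V|%:R; have n0 : 0 < n by rewrite ltr0n.
set i0 := c w0; set Y := _ :&: _ in xq.
pose G := [set g in ordered_edges k EH | g \in insert_ffun i0 @: setX [set: V] Y].
have dG : p ^+ 2 * a / 4 * n ^+ #|'I_k| <= #|G|%:R.
  apply: le_trans (edge_dense_ordered i0 [set: V] Y dE); rewrite card_ord cardsT -/n.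
  have nk : n ^+ k = n * n ^+ k.-1 by rewrite -exprS prednK.
  have h : p / 2 * (a * n ^+ k.-1) <= #|Y|%:R.
    by apply: le_trans xq; rewrite ler_wpM2l // divr_ge0 // ltW.
  have := ler_wpM2l (ltW (mulr_gt0 p0 n0)) h.
  have := ler_wpM2r (ltW (exprn_gt0 k n0)) Hmu; rewrite !nk.
  set N := n ^+ k.-1 => H1 H2; nra.
have d0 : 0 <= p ^+ 2 * a / 4 by rewrite divr_ge0 // mulr_ge0 ?exprn_ge0 // ltW.
apply: le_trans (card_blowup_homs c V0 d0 dG) _.
rewrite ler_nat; apply: subset_leq_card; apply/subsetP => phi Hphi; rewrite inE.
have GE : G \subset ordered_edges k EH by apply/subsetP => g; rewrite inE => /andP[].
have Gu v : Y \subset ordered_link k EH v ->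
    forall g, g \in G -> upd g i0 v \in ordered_edges k EH.
  move=> /subsetP Yv g; rewrite inE => /andP[_ /imsetP[[u y]]].
  rewrite in_setX => /andP[_ /Yv yv] ->; rewrite upd_insert_ffun inE imset_insert_ffun.
  by move: yv; rewrite inE.
rewrite (blowup_hom_upd Hc GE (Gu q (subsetIr _ _)) Hphi).
by rewrite (blowup_hom_upd Hc GE (Gu x (subsetIl _ _)) Hphi).
Qed.

(** Union bound over ordered pairs of colliding coordinates and over coordinates that land in
    [U]. *)
Lemma card_ffun_bad (R : realType) (M V : finType) (U : {set V}) : (0 < #|V|)%N ->
  #|V|%:R * #|[set T : {ffun M -> V} | ~~ injectiveb T || [exists m, T m \in U]]|%:R
    <= (#|M|%:R ^+ 2 + #|M|%:R * #|U|%:R) * #|V|%:R ^+ #|M| :> R.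
Proof.
move=> V0; set n : R := #|V|%:R; have n0 : 0 < n by rewrite ltr0n.
have H : #|[set T : {ffun M -> V} | ~~ injectiveb T || [exists m, T m \in U]]|%:R
    <= \sum_(u : M * M) #|[set T : {ffun M -> V} | (u.1 != u.2) && (T u.1 == T u.2)]|%:R
     + \sum_m #|[set T : {ffun M -> V} | T m \in U]|%:R :> R.
  under eq_bigr do rewrite card_sum1; under [X in _ + X]eq_bigr do rewrite card_sum1.
  rewrite !card_sum1 exchange_big [X in _ + X]exchange_big -big_split /=.
  apply: ler_sum => T _; rewrite inE.
  case: (boolP (injectiveb T)) => [_|/injectivePn[a [b ab Tab]]].
    case: existsP => [[m Tm]|_]; rewrite /= ?addr_ge0 ?sumr_ge0 //.
    by rewrite (bigD1 m) //= inE Tm addrCA lerDl addr_ge0 ?sumr_ge0.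
  rewrite (bigD1 (a, b)) //= inE ab Tab eqxx -addrA lerDl.
  by rewrite addr_ge0 ?sumr_ge0.
apply: le_trans (ler_wpM2l (ltW n0) H) _.
rewrite mulrDr !mulr_sumr mulrDl; apply: lerD.
  apply: (@le_trans _ _ (\sum_(u : M * M) n ^+ #|M|)).
    apply: ler_sum => -[a b] _ /=; case: (eqVneq a b) => [->|ab] /=.
      have -> : [set T : {ffun M -> V} | false] = set0 by apply/setP => T; rewrite !inE.
      by rewrite cards0 mulr0 exprn_ge0 // ltW.
    rewrite -(card_coord_eq _ _ ab); apply: ler_wpM2l; first exact: ltW.
    rewrite ler_nat; by apply: subset_leq_card; apply/subsetP => T; rewrite !inE.
  by rewrite sumr_const card_prod -[_ *+ _]mulr_natl natrM expr2.
rewrite -mulrA -sumr_const; under eq_bigr do rewrite card_coord.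
by rewrite sumr_const sumr_const -[leLHS]mulr_natl mulr_natl.
Qed.

(** * Tilings by disjoint copies *)

(** Records only the covered vertex set, so that tilings can be regrouped by set algebra; the blocks
    are recovered once, in [tiled_partition]. *)
Inductive tiled (W V : finType) (EF : {set {set W}}) (EH : {set {set V}}) :
    {set V} -> Prop :=
| tiled0 : tiled EF EH set0
| tiledU B A : copy_on EF EH B -> tiled EF EH A -> [disjoint B & A] ->
    tiled EF EH (B :|: A).

Lemma tiledUU (W V : finType) (EF : {set {set W}}) (EH : {set {set V}}) (A B : {set V}) :
  tiled EF EH A -> tiled EF EH B -> [disjoint A & B] -> tiled EF EH (A :|: B).
Proof.
elim=> [tB _|C A' cC _ IH dCA tB]; first by rewrite set0U.
rewrite -!setI_eq0 setIUl setU_eq0 !setI_eq0 => /andP[dCB dAB].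
rewrite -setUA; apply: tiledU => //; first exact: IH.
by rewrite -setI_eq0 setIUr setU_eq0 !setI_eq0 dCA dCB.
Qed.

Lemma copy_tiled (W V : finType) (EF : {set {set W}}) (EH : {set {set V}}) (B : {set V}) :
  copy_on EF EH B -> tiled EF EH B.
Proof.
by move=> cB; rewrite -[B]setU0; apply: tiledU => //; [exact: tiled0|rewrite -setI_eq0 setI0].
Qed.

Lemma tiled_bigcup (W V I : finType) (EF : {set {set W}}) (EH : {set {set V}})
    (P : {set I}) (B : I -> {set V}) :
  (forall i, i \in P -> tiled EF EH (B i)) ->
  {in P &, forall i j, i != j -> [disjoint B i & B j]} ->
  tiled EF EH (\bigcup_(i in P) B i).
Proof.
have [n] := ubnP #|P|; elim: n P => // n IH P leP tB dB; have [->|[i iP]] := set_0Vmem P.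
  by rewrite big_set0; exact: tiled0.
rewrite (big_setD1 i) //=; apply: tiledUU; first exact: tB.
- apply: IH.
  + by rewrite (cardsD1 i P) iP in leP.
  + by move=> j /setD1P[_ /tB].
  + by move=> j l /setD1P[_ jP] /setD1P[_ lP]; apply: dB.
- apply/bigcup_disjointP => j /setD1P[ji jP].
  by apply: dB; rewrite // eq_sym.
Qed.

Lemma tiled_partition (W V : finType) (EF : {set {set W}}) (EH : {set {set V}})
    (A : {set V}) : (0 < #|W|)%N -> tiled EF EH A ->
  exists P : {set {set V}}, partition P A /\ forall B, B \in P -> copy_on EF EH B.
Proof.
move=> /card_gt0P[w _]; elim=> [|B C cB _ [P [pP cP]] dBC].
  by exists set0; split; [rewrite partition_set0|move=> B; rewrite inE].
exists (B |: P); split; last by move=> X /setU1P[->|/cP].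
have B0 : B != set0.
  case: cB => phi [_ [<- _]]; apply/set0Pn; exists (phi w); exact: imset_f.
case/and3P: pP => /eqP cov tri P0.
have dBP : forall X, X \in P -> [disjoint B & X].
  move=> X XP; apply: disjointWr dBC; rewrite -cov; exact: (bigcup_sup X).
have [triB BP] := trivIsetU1 dBP tri P0.
apply/and3P; split => //; last by rewrite in_setU1 negb_or eq_sym B0.
by rewrite /cover big_setU1 //= -cov.
Qed.

Lemma tiled_dvdn (W V : finType) (EF : {set {set W}}) (EH : {set {set V}})
    (A : {set V}) : tiled EF EH A -> (#|W| %| #|A|)%N.
Proof.
elim=> [|B C [phi [phi_inj [<- _]]] _ IH dBC]; first by rewrite cards0 dvdn0.
rewrite cardsU; move: dBC; rewrite -setI_eq0 => /eqP ->; rewrite cards0 subn0.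
by rewrite dvdn_add // card_imset // cardsT.
Qed.

(** * Absorbers and their number *)

(* In a map T : option W * W -> V, the row None is the copy D and the row Some w the
   partial copy attached to w; the value T (Some w, w0) is not used. *)
Definition row_ffun (W V : finType) (T : {ffun option W * W -> V}) (o : option W) :
    {ffun W -> V} := [ffun w => T (o, w)].

Definition absorber_homs (W V : finType) (EF : {set {set W}}) (EH : {set {set V}})
    (w0 : W) (T : {ffun option W * W -> V}) (e : {ffun W -> V}) : bool :=
  [forall w, ffun_hom EF EH (upd (row_ffun T (Some w)) w0 (e w))].

Definition absorber_core (W V : finType) (w0 : W) (T : {ffun option W * W -> V}) : {set V} :=
  [set T (Some u.1, u.2) | u in [set u : W * W | u.2 != w0]].

(** Row w completed by [e w] at [w0] is a copy of F. These copies are injective and pairwise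
    disjoint because [T] and [e] are injective and [e] avoids the core. *)
Lemma tiled_core (W V : finType) (EF : {set {set W}}) (EH : {set {set V}})
    (w0 : W) (T : {ffun option W * W -> V}) (e : {ffun W -> V}) :
  injective T -> injective e -> (forall w, e w \notin absorber_core w0 T) ->
  absorber_homs EF EH w0 T e -> tiled EF EH (e @: [set: W] :|: absorber_core w0 T).
Proof.
move=> Tinj einj eT /forallP He.
pose f w := upd (row_ffun T (Some w)) w0 (e w).
have eNT w w1 w2 : w2 != w0 -> e w != T (Some w1, w2).
  move=> w20; apply: contraNneq (eT w) => ->.
  by apply/imsetP; exists (w1, w2); rewrite ?inE.
have finj w : injective (f w).
  move=> x y; rewrite !ffunE; case: eqP => [->|/eqP x0]; case: eqP => [->|/eqP y0] //.
  - by move/eqP; rewrite (negbTE (eNT _ _ _ y0)).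
  - by move/esym/eqP; rewrite (negbTE (eNT _ _ _ x0)).
  - by move/Tinj => -[].
have -> : e @: [set: W] :|: absorber_core w0 T = \bigcup_(w in [set: W]) (f w @: [set: W]).
  apply/setP => v; apply/setUP/bigcupP.
    case=> /imsetP; first case=> w _ ->.
      by exists w => //; apply/imsetP; exists w0; rewrite ?ffunE ?eqxx.
    case=> -[w x]; rewrite inE /= => x0 ->; exists w => //.
    by apply/imsetP; exists x; rewrite // !ffunE (negbTE x0).
  case=> w _ /imsetP[x _ ->]; rewrite !ffunE; case: eqP => [_|/eqP x0].
    by left; exact: imset_f.
  by right; apply/imsetP; exists (w, x); rewrite ?inE.
apply: tiled_bigcup => [w _|w w' _ _ ww'].
  apply: copy_tiled; exists (f w); split; [exact: finj|split => // d dF].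
  by have /forall_inP := He w; apply.
rewrite -setI_eq0; apply/eqP/setP => v; rewrite inE in_set0.
apply/negbTE/negP => /andP[/imsetP[x _ ->] /imsetP[y _]].
rewrite !ffunE; case: eqP => [_|/eqP x0]; case: eqP => [_|/eqP y0].
- by move/einj => E; move: ww'; rewrite E eqxx.
- by move/eqP; rewrite (negbTE (eNT _ _ _ y0)).
- by move/esym/eqP; rewrite (negbTE (eNT _ _ _ x0)).
- by move/Tinj => -[E]; move: ww'; rewrite E eqxx.
Qed.

Definition absorbers (W V : finType) (EF : {set {set W}}) (EH : {set {set V}})
    (w0 : W) (q : {ffun W -> V}) : {set {ffun option W * W -> V}} :=
  [set T | [&& ffun_hom EF EH (row_ffun T None),
             absorber_homs EF EH w0 T q & absorber_homs EF EH w0 T (row_ffun T None)]].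

Definition absorber_set (W V : finType) (w0 : W) (T : {ffun option W * W -> V}) : {set V} :=
  row_ffun T None @: [set: W] :|: absorber_core w0 T.

Lemma absorber_set_sub (W V : finType) (w0 : W) (T : {ffun option W * W -> V}) :
  absorber_set w0 T \subset T @: setT.
Proof.
apply/subsetP => v /setUP[] /imsetP[u _ ->]; rewrite ?ffunE; exact: imset_f.
Qed.

Lemma row_None_notin_core (W V : finType) (w0 : W) (T : {ffun option W * W -> V}) (w : W) :
  injective T -> row_ffun T None w \notin absorber_core w0 T.
Proof. by move=> Tinj; apply/imsetP => -[u _]; rewrite ffunE => /Tinj. Qed.

Lemma row_ffun_inj (W V : finType) (T : {ffun option W * W -> V}) (o : option W) :
  injective T -> injective (row_ffun T o).
Proof. by move=> Tinj x y; rewrite !ffunE => /Tinj[]. Qed.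

Lemma tiled_absorber_set (W V : finType) (EF : {set {set W}}) (EH : {set {set V}})
    (w0 : W) (q : {ffun W -> V}) (T : {ffun option W * W -> V}) :
  injective T -> T \in absorbers EF EH w0 q -> tiled EF EH (absorber_set w0 T).
Proof.
move=> Tinj; rewrite inE => /and3P[_ _ H]; apply: tiled_core => //.
  exact: row_ffun_inj.
by move=> w; exact: row_None_notin_core.
Qed.

Lemma tiled_absorber_setU (W V : finType) (EF : {set {set W}}) (EH : {set {set V}})
    (w0 : W) (q : {ffun W -> V}) (T : {ffun option W * W -> V}) :
  injective T -> injective q -> [disjoint q @: [set: W] & T @: [set: option W * W]] ->
  T \in absorbers EF EH w0 q -> tiled EF EH (absorber_set w0 T :|: q @: [set: W]).
Proof.
move=> Tinj qinj qT; rewrite inE => /and3P[hD hq _].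
have coreT : absorber_core w0 T \subset T @: setT.
  by apply: subset_trans (absorber_set_sub w0 T); exact: subsetUr.
rewrite /absorber_set -setUA [_ :|: q @: _]setUC; apply: tiledUU.
- apply: copy_tiled; exists (row_ffun T None); split; first exact: row_ffun_inj.
  by split => // d dF; move/forall_inP: hD; apply.
- apply: tiled_core => // w; apply: contraTN qT => /(subsetP coreT) qwT.
  by apply/pred0Pn; exists (q w); rewrite /= qwT imset_f.
- rewrite -setI_eq0 setIUr setU_eq0; apply/andP; split.
    rewrite setI_eq0 disjoint_sym; apply: disjointWr qT.
    by apply: subset_trans (absorber_set_sub w0 T); exact: subsetUl.
  apply/eqP/setP => v; rewrite in_setI in_set0; apply/negbTE/negP => /andP[/imsetP[w _ ->]].
  by apply/negP; exact: row_None_notin_core.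
Qed.

Definition glue_rows (W V : finType) (u : {ffun W -> V} * {ffun W -> {ffun W -> V}}) :
    {ffun option W * W -> V} :=
  [ffun m => if m.1 is Some w then u.2 w m.2 else u.1 m.2].

Lemma glue_rows_inj (W V : finType) : injective (@glue_rows W V).
Proof.
move=> [D S] [D' S'] /ffunP E; congr pair; apply/ffunP => w.
  by have := E (None, w); rewrite !ffunE.
by apply/ffunP => x; have := E (Some w, x); rewrite !ffunE.
Qed.

(** Once the row [None] is fixed to D, the other rows are chosen independently, so D contributes the
    product over w of |[Rel D w]|. *)
Lemma card_dependent_rows (R : realFieldType) (W V : finType) (A : {set {ffun W -> V}})
    (Rel : {ffun W -> V} -> W -> {set {ffun W -> V}}) (x y : R) :
  0 <= y -> x <= #|A|%:R -> (forall D w, D \in A -> y <= #|Rel D w|%:R) ->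
  x * y ^+ #|W| <= #|[set T : {ffun option W * W -> V} | (row_ffun T None \in A)
     && [forall w, row_ffun T (Some w) \in Rel (row_ffun T None) w]]|%:R.
Proof.
move=> y0 xA yR.
pose P := [set u : {ffun W -> V} * {ffun W -> {ffun W -> V}} |
  (u.1 \in A) && [forall w, u.2 w \in Rel u.1 w]].
have HP : x * y ^+ #|W| <= #|P|%:R.
  rewrite card_sum1 (eq_bigr (fun u : {ffun W -> V} * {ffun W -> {ffun W -> V}} =>
    (u.1 \in A)%:R * [forall w, u.2 w \in Rel u.1 w]%:R));
    last by move=> u _; rewrite inE -natrM mulnb.
  rewrite -(pair_bigA _ (fun (D : {ffun W -> V}) (S : {ffun W -> {ffun W -> V}}) =>
    (D \in A)%:R * [forall w, S w \in Rel D w]%:R)) /=.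
  apply: le_trans (ler_wpM2r (exprn_ge0 _ y0) xA) _.
  rewrite card_sum1 mulr_suml; apply: ler_sum => D _; rewrite -mulr_sumr.
  case: (boolP (D \in A)) => DA; last by rewrite !mul0r.
  rewrite !mul1r.
  have -> : \sum_(S : {ffun W -> {ffun W -> V}}) [forall w, S w \in Rel D w]%:R
      = #|family (fun w => mem (Rel D w))|%:R :> R.
    by rewrite -cardsE card_sum1; apply: eq_bigr => S _; rewrite inE.
  rewrite card_family foldrE big_image /= natr_prod -prodr_const.
  by apply: ler_prod => w _; rewrite y0 yR.
apply: le_trans HP _; rewrite ler_nat -(card_imset _ (@glue_rows_inj W V)).
apply: subset_leq_card; apply/subsetP => T /imsetP[[D S]]; rewrite !inE /= => /andP[DA HS] ->.
have -> : row_ffun (glue_rows (D, S)) None = D by apply/ffunP => w; rewrite !ffunE.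
rewrite DA; apply/forallP => w.
have -> : row_ffun (glue_rows (D, S)) (Some w) = S w by apply/ffunP => v; rewrite !ffunE.
exact: (forallP HS).
Qed.

(** Choose D first: at most half of the guaranteed homomorphisms are lost by forbidding each D w to
    be a poor partner of q w. Then [card_link_switch] counts the choices for each row w. *)
Lemma card_absorbers (R : realType) (k : nat) (W V : finType) (EF : {set {set W}})
    (EH : {set {set V}}) (c : W -> 'I_k) (p a mu : R) (w0 : W) (q : {ffun W -> V}) :
  (0 < k)%N -> (0 < #|V|)%N -> kcoloring EF c -> is_kgraph k EH ->
  edge_dense k EH p mu -> min_codeg1_ge k EH a ->
  0 < p -> 0 < a -> mu <= p / 2 -> mu <= p ^+ 2 * a / 4 ->
  #|W|%:R * (2 * mu / (p * a)) <= (p / 2) ^+ (2 ^ #|W|) / 2 ->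
  (p / 2) ^+ (2 ^ #|W|) / 2 * (p ^+ 2 * a / 4) ^+ (2 ^ #|W| * #|W|)
    * #|V|%:R ^+ #|{: option W * W}| <= #|absorbers EF EH w0 q|%:R.
Proof.
move=> k0 V0 Hc kH dE dH p0 a0 mu1 mu2 mu3.
have aq v : a * #|V|%:R ^+ k.-1 <= #|ordered_link k EH v|%:R.
  by apply: le_trans (dH v) _; rewrite ler_nat vdeg_le_link.
have W0 : (0 < #|W|)%N by apply/card_gt0P; exists w0.
set f := #|W| in mu3 *; set n : R := #|V|%:R.
have n0 : 0 < n by rewrite ltr0n.
pose A := [set D in [set phi : {ffun W -> V} | ffun_hom EF EH phi && [forall w, phi w \in [set: V]]]
  | [forall w, D w \notin poor_partners k EH p (q w)]].
pose Rel (D : {ffun W -> V}) w := [set phi : {ffun W -> V} |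
  ffun_hom EF EH (upd phi w0 (q w)) && ffun_hom EF EH (upd phi w0 (D w))].
have cA : (p / 2) ^+ (2 ^ f) / 2 * n ^+ f <= #|A|%:R.
  have h1 := card_hom_within (X := [set: V]) (eta := 1) k0 W0 V0 Hc dE (ltW p0) ler01.
  rewrite mul1r cardsT expr1n mulr1 in h1; have {}h1 := h1 (lexx _) mu1.
  apply: le_trans (card_hom_avoid V0 h1 (fun w =>
    card_poor_partners k0 V0 p0 a0 dE (aq (q w)))).
  rewrite ler_wpM2r ?exprn_ge0 ?(ltW n0) //; move: mu3; rewrite -/f; lra.
have cR D w : D \in A -> (p ^+ 2 * a / 4) ^+ (2 ^ f) * n ^+ f <= #|Rel D w|%:R.
  rewrite inE => /andP[_ /forallP DB].
  exact: card_link_switch k0 V0 Hc dE p0 a0 mu2 (aq _) (DB w).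
have y0 : 0 <= (p ^+ 2 * a / 4) ^+ (2 ^ f) * n ^+ f.
  by rewrite mulr_ge0 ?exprn_ge0 ?divr_ge0 ?mulr_ge0 ?exprn_ge0 ?ltW.
have := card_dependent_rows y0 cA cR.
have -> : (p / 2) ^+ (2 ^ f) / 2 * n ^+ f * ((p ^+ 2 * a / 4) ^+ (2 ^ f) * n ^+ f) ^+ #|W|
  = (p / 2) ^+ (2 ^ f) / 2 * (p ^+ 2 * a / 4) ^+ (2 ^ f * f) * n ^+ #|{: option W * W}|.
  rewrite card_prod card_option -/f mulSn exprD (exprMn f ((p ^+ 2 * a / 4) ^+ (2 ^ f)) (n ^+ f)).
  by rewrite !(exprM _ _ f) -!mulrA; congr (_ * (_ * _)); rewrite mulrCA.
move=> H; apply: le_trans H _; rewrite ler_nat; apply: subset_leq_card.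
apply/subsetP => T; rewrite !inE -!andbA => /and4P[-> _ _ /forallP HT] /=.
by apply/andP; split; apply/forallP => w; have := HT w; rewrite inE => /andP[].
Qed.

(** Injectivity and disjointness from [q] are imposed only here, since the maps violating them are
    of lower order and can be subtracted after the density count. *)
Definition clean_absorbers (W V : finType) (EF : {set {set W}}) (EH : {set {set V}})
    (w0 : W) (q : {ffun W -> V}) : {set {ffun option W * W -> V}} :=
  [set T in absorbers EF EH w0 q |
     injectiveb T && [disjoint q @: [set: W] & T @: [set: option W * W]]].

Lemma card_clean_absorbers (R : realType) (W V : finType) (EF : {set {set W}})
    (EH : {set {set V}}) (w0 : W) (q : {ffun W -> V}) (U : {set V}) (c : R) :
  (0 < #|V|)%N ->
  let m : R := #|{: option W * W}|%:R in
  c * #|V|%:R ^+ #|{: option W * W}| <= #|absorbers EF EH w0 q|%:R ->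
  m ^+ 2 + m * (#|U|%:R + #|W|%:R) <= c / 2 * #|V|%:R ->
  c / 2 * #|V|%:R ^+ #|{: option W * W}|
    <= #|[set T in clean_absorbers EF EH w0 q | [disjoint T @: [set: option W * W] & U]]|%:R.
Proof.
move=> V0 m cA mU; set n : R := #|V|%:R; have n0 : 0 < n by rewrite ltr0n.
set U' := U :|: q @: [set: W].
have := card_ffun_bad R (option W * W)%type U' V0.
move=> cB; pose Bad := [set T : {ffun option W * W -> V} | ~~ injectiveb T || [exists m, T m \in U']].
rewrite -/Bad in cB.
have U'le : #|U'|%:R <= #|U|%:R + #|W|%:R :> R.
  rewrite -natrD ler_nat (leq_trans (leq_card_setU _ _)) // leq_add2l.
  by rewrite -cardsT leq_imset_card.
have {}cB : #|Bad|%:R <= c / 2 * n ^+ #|{: option W * W}|.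
  rewrite -(ler_pM2l n0); apply: le_trans cB _; rewrite -/n -/m mulrCA mulrA.
  rewrite -/n in mU.
  rewrite ler_wpM2r ?exprn_ge0 ?(ltW n0) //; apply: le_trans mU.
  by rewrite lerD2l ler_wpM2l // ler0n.
have : #|absorbers EF EH w0 q|%:R <= #|[set T in clean_absorbers EF EH w0 q |
     [disjoint T @: [set: option W * W] & U]]|%:R + #|Bad|%:R :> R.
  rewrite -natrD ler_nat; apply: leq_trans (leq_card_setU _ _); apply: subset_leq_card.
  apply/subsetP => T TA; rewrite !inE; case: (injectiveb T); last by rewrite orbT.
  case: (boolP [exists m0, T m0 \in U']) => [_|]; first by rewrite !orbT.
  rewrite negb_exists => /forallP HT; move: TA; rewrite inE => ->.
  rewrite /= orbF; apply/andP; split; rewrite -setI_eq0; apply/eqP/setP => v;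
    rewrite in_setI in_set0; apply/negbTE/negP.
    case/andP => vq /imsetP[u _ vu]; have := HT u.
    by rewrite -vu in_setU vq orbT.
  by case/andP => /imsetP[u _ ->] uU; have := HT u; rewrite in_setU uU.
move: cA; rewrite -/n; lra.
Qed.

(** * Numerical estimates *)

Lemma expn_lt_exp2_divn (f K : nat) : (0 < f)%N -> (0 < K)%N ->
  exists n0, forall n, (n0 <= n)%N -> (n ^ f < 2 ^ (n %/ K))%N.
Proof.
(* With s = n %/ (2fK) and n at least (2fK)^2, one has n < (s+1)^2 and s+1 <= 2^s, hence n^f <
   2^(2fs) <= 2^(n %/ K). *)
move=> f0 K0; set b := (2 * f * K)%N; have b0 : (0 < b)%N by rewrite !muln_gt0 f0 K0.
exists (b * b)%N => n nb; set s := (n %/ b)%N.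
have bs : (b <= s)%N by rewrite leq_divRL.
have ns : (n < s.+1 * s.+1)%N.
  apply: leq_trans (_ : s.+1 * b <= _)%N; first by rewrite -ltn_divLR.
  by rewrite leq_mul2l ltnW ?orbT // ltnS.
have sq : (s * (2 * f) <= n %/ K)%N.
  by rewrite leq_divRL // -mulnA -/b leq_trunc_div.
apply: leq_trans (_ : 2 ^ (s * (2 * f)) <= _)%N; last by rewrite leq_exp2l.
apply: leq_trans (_ : (s.+1 * s.+1) ^ f <= _)%N; first by rewrite ltn_exp2r.
by rewrite expnM expnM leq_exp2r // mulnn leq_sqr ltn_expl.
Qed.

(** A Bernoulli-type bound: (1-x)^L (1+Lx) <= 1, applied with Lx > 3. *)
Lemma exists_expr_le_quarter (R : realType) (x : R) : 0 < x -> x <= 1 ->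
  exists L : nat, (1 - x) ^+ L <= 4^-1.
Proof.
move=> x0 x1.
have H L : (1 - x) ^+ L * (1 + L%:R * x) <= 1.
  elim: L => [|L IH]; first by rewrite expr0 mul0r addr0 mulr1.
  apply: le_trans IH; rewrite exprSr -mulrA ler_wpM2l ?exprn_ge0 ?subr_ge0 //.
  have L0 : 0 <= L%:R :> R by [].
  by rewrite -natr1; nra.
pose L := Num.bound (3 / x).
have HL : 3 / x < L%:R.
  by rewrite /L archi_boundP // divr_ge0 // ltW.
exists L; have := H L; move: HL; rewrite ltr_pdivrMr // => HL.
have : 0 <= (1 - x) ^+ L by rewrite exprn_ge0 // subr_ge0.
by set y := _ ^+ L; nra.
Qed.

(** * Greedy choice of a disjoint family *)

Definition disjoint_family (I V : finType) (vs : I -> {set V}) (S : {set I}) : Prop :=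
  {in S &, forall i j, i != j -> [disjoint vs i & vs j]}.

(** An index with at most r chosen members contributes at least 2^-r, so a small potential forces
    every index to have many. *)
Definition potential (R : realFieldType) (J I : finType) (ab : J -> {set I})
    (S : {set I}) : R := \sum_j 2^-1 ^+ #|ab j :&: S|.

(* Method of conditional expectations: a uniformly random admissible [i] multiplies the potential by at most [1 - beta / 2] on average. *)
Lemma greedy_step (R : realFieldType) (J I V : finType) (ab : J -> {set I})
    (vs : I -> {set V}) (beta : R) (S : {set I}) (j0 : J) :
  0 < beta -> (0 < #|I|)%N ->
  (forall j, beta * #|I|%:R
     <= #|[set i in ab j | [disjoint vs i & \bigcup_(l in S) vs l]]|%:R) ->
  (forall i j, i \in ab j -> vs i != set0) ->
  exists i, [/\ exists j, i \in ab j, i \notin S,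
    [disjoint vs i & \bigcup_(l in S) vs l]
    & potential R ab (i |: S) <= (1 - beta / 2) * potential R ab S].
Proof.
move=> b0 I0 Hab vs0; set U := \bigcup_(l in S) vs l in Hab *.
pose A j := [set i in ab j | [disjoint vs i & U]].
pose I' := [set i | [exists j, i \in A j]].
have AI' j : A j = I' :&: ab j.
  apply/setP => i; rewrite !inE; apply/idP/idP => [/andP[iab dU]|/andP[/existsP[l]]].
    by rewrite iab andbT; apply/existsP; exists j; rewrite inE iab dU.
  by rewrite inE => /andP[_ ->] ->.
have notS i : i \in I' -> i \notin S.
  rewrite inE => /existsP[j]; rewrite inE => /andP[/vs0 vi dU]; apply: contraNN vi => iS.
  rewrite -subset0; move: dU; rewrite -setI_eq0 => /eqP <-.
  by rewrite subsetI subxx (bigcup_sup i).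
have [/exists_inP[i iI' Hi]|] := boolP [exists i in I', potential R ab (i |: S) <= (1 - beta / 2) * potential R ab S].
  exists i; split; rewrite ?notS //; move: iI'; rewrite inE => /existsP[j].
    by rewrite inE => /andP[ij _]; exists j.
  by rewrite inE => /andP[].
rewrite negb_exists_in => /forall_inP Hbad; exfalso.
have I'0 : (0 < #|I'|)%N.
  have : 0 < #|A j0|%:R :> R by apply: lt_le_trans (Hab j0); rewrite mulr_gt0 ?ltr0n.
  rewrite ltr0n => /leq_trans; apply; apply: subset_leq_card; rewrite AI'; exact: subsetIl.
(* For fixed j, the members of [A j] halve the term of j and the others leave it unchanged; [A j]
   has size at least [beta] |I|, hence at least [beta] |I'|. *)
have upper : \sum_(i in I') potential R ab (i |: S) <= #|I'|%:R * ((1 - beta / 2) * potential R ab S).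
  rewrite exchange_big /= mulrA mulr_sumr; apply: ler_sum => j _.
  have -> : \sum_(i in I') 2^-1 ^+ #|ab j :&: (i |: S)|
      = 2^-1 ^+ #|ab j :&: S| * (#|I'|%:R - #|A j|%:R / 2) :> R.
    transitivity (\sum_(i in I') 2^-1 ^+ #|ab j :&: S| * (1 - (i \in ab j)%:R / 2) : R).
      apply: eq_bigr => i iI'; have := notS i iI' => iS.
      case: (boolP (i \in ab j)) => iab.
        have -> : ab j :&: (i |: S) = i |: (ab j :&: S).
          by apply/setP => l; rewrite !inE; case: eqP => // ->; rewrite iab.
        by rewrite cardsU1 inE (negbTE iS) andbF exprS /=; lra.
      have -> : ab j :&: (i |: S) = ab j :&: S.
        by apply/setP => l; rewrite !inE; case: eqP => // ->; rewrite (negbTE iab).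
      by rewrite mul0r subr0 mulr1.
    rewrite -mulr_sumr sumrB sumr_const -mulr_suml; congr (_ * (_ - _ / 2)).
    rewrite AI' card_sum1 big_mkcond; apply: eq_bigr => i _.
    by rewrite in_setI; case: (i \in I').
  rewrite [leRHS]mulrC ler_wpM2l ?exprn_ge0 ?invr_ge0 //.
  have : #|I'|%:R <= #|I|%:R :> R by rewrite ler_nat max_card.
  by move=> /(ler_wpM2l (ltW b0)); have := Hab j; rewrite -/(A j); lra.
have lower : #|I'|%:R * ((1 - beta / 2) * potential R ab S) < \sum_(i in I') potential R ab (i |: S).
  rewrite mulr_natl -sumr_const; have /card_gt0P[i iI'] := I'0.
  rewrite (bigD1 i) //= [ltRHS](bigD1 i) //=; apply: ltr_leD.
    by rewrite ltNge; exact: Hbad.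
  by apply: ler_sum => l /andP[lI' _]; rewrite leNgt; apply: contra (Hbad l lI') => /ltW.
by have := lt_le_trans lower upper; rewrite ltxx.
Qed.

(** Iterate [greedy_step] from the empty family, of potential |J|. After N <= N0 steps at most m N
    vertices are used, so the hypothesis still applies, and at the end each single term is bounded
    by the whole potential. *)
Lemma greedy_family (R : realFieldType) (J I V : finType) (ab : J -> {set I})
    (vs : I -> {set V}) (beta : R) (m N0 : nat) (j0 : J) :
  0 < beta -> beta <= 1 -> (0 < #|I|)%N ->
  (forall j (U : {set V}), (#|U| <= m * N0)%N ->
     beta * #|I|%:R <= #|[set i in ab j | [disjoint vs i & U]]|%:R) ->
  (forall i, (#|vs i| <= m)%N) -> (forall i j, i \in ab j -> vs i != set0) ->
  exists S : {set I}, [/\ forall i, i \in S -> exists j, i \in ab j, disjoint_family vs S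
    & forall j, 2^-1 ^+ #|ab j :&: S| <= #|J|%:R * (1 - beta / 2) ^+ N0].
Proof.
move=> b0 b1 I0 Hab vsm vs0.
suff H N : (N <= N0)%N -> exists S : {set I},
    [/\ forall i, i \in S -> exists j, i \in ab j, disjoint_family vs S,
        (#|\bigcup_(i in S) vs i| <= m * N)%N
      & potential R ab S <= #|J|%:R * (1 - beta / 2) ^+ N].
  have [S [S1 S2 _ S3]] := H _ (leqnn N0); exists S; split=> // j.
  apply: le_trans S3; rewrite /potential (bigD1 j) //= lerDl sumr_ge0 // => l _.
  by rewrite exprn_ge0 // invr_ge0.
elim: N => [_|N IH NN0].
  exists set0; split.
  - by move=> i; rewrite inE.
  - by move=> i j; rewrite inE.
  - by rewrite big_set0 cards0.
  rewrite expr0 mulr1 /potential; under eq_bigr do rewrite setI0 cards0 expr0.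
  by rewrite sumr_const.
have [S [S1 S2 S3 S4]] := IH (ltnW NN0).
have Hab' j : beta * #|I|%:R
     <= #|[set i in ab j | [disjoint vs i & \bigcup_(l in S) vs l]]|%:R.
  by apply: Hab; apply: leq_trans S3 _; rewrite leq_mul2l (ltnW NN0) orbT.
have [i [iab iS dU Hp]] := greedy_step j0 b0 I0 Hab' vs0.
have di l : l \in S -> [disjoint vs i & vs l].
  by move=> lS; apply: disjointWr dU; exact: (bigcup_sup l).
exists (i |: S); split.
- by move=> l /setU1P[->|/S1].
- move=> x y /setU1P[->|xS] /setU1P[->|yS]; rewrite ?eqxx // => xy; first exact: di.
    by rewrite disjoint_sym; exact: di.
  exact: S2.
- rewrite big_setU1 //= mulnS (leq_trans (leq_card_setU _ _)) // leq_add //; exact: vsm.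
- apply: le_trans Hp _; rewrite exprS mulrCA ler_wpM2l // subr_ge0; lra.
Qed.

(** * Absorbing the leftover and assembling the factor *)

Lemma exists_embedding (W V : finType) (X : {set V}) : (#|W| <= #|X|)%N ->
  exists q : {ffun W -> V}, injective q /\ q @: [set: W] \subset X.
Proof.
move=> WX; exists [ffun w => enum_val (widen_ord WX (enum_rank w))]; split.
  move=> x y; rewrite !ffunE => /enum_val_inj/(congr1 val)/= E.
  by apply: enum_rank_inj; apply: val_inj.
by apply/subsetP => v /imsetP[w _ ->]; rewrite ffunE enum_valP.
Qed.

(** Induction on [r]: embed one tuple q in [X] and spend one absorber of q on it. Every other tuple
    loses at most one absorber from [S]. *)
Lemma absorb (W V I : finType) (EF : {set {set W}}) (EH : {set {set V}})
    (ab : {ffun W -> V} -> {set I}) (vs : I -> {set V}) (r : nat) (X : {set V})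
    (S : {set I}) :
  (forall (q : {ffun W -> V}) i, injective q -> i \in ab q -> tiled EF EH (vs i :|: q @: [set: W])) ->
  (#|X| = r * #|W|)%N -> [disjoint X & \bigcup_(i in S) vs i] ->
  (forall i, i \in S -> tiled EF EH (vs i)) -> disjoint_family vs S ->
  (forall q, r <= #|ab q :&: S|)%N ->
  tiled EF EH (\bigcup_(i in S) vs i :|: X).
Proof.
move=> Hab; elim: r X S => [|r IH] X S cX dX tS dS abS.
  by rewrite (cards0_eq cX) setU0; exact: tiled_bigcup.
have [|q [qinj qX]] := @exists_embedding W V X; first by rewrite cX mulSn leq_addr.
have /card_gt0P[i] : (0 < #|ab q :&: S|)%N by apply: leq_ltn_trans (abS q).
case/setIP => iq iS; set Q := q @: [set: W] in qX.
have dSi : [disjoint vs i & \bigcup_(l in S :\ i) vs l].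
  by apply/bigcup_disjointP => l /setD1P[li lS]; apply: dS; rewrite // eq_sym.
have sub : \bigcup_(l in S :\ i) vs l \subset \bigcup_(l in S) vs l.
  by apply/bigcupsP => l /setD1P[_ lS]; exact: (bigcup_sup l).
have dXi : [disjoint X & vs i] by apply: disjointWr dX; exact: (bigcup_sup i).
have dXU : [disjoint X & \bigcup_(l in S :\ i) vs l] := disjointWr sub dX.
have -> : \bigcup_(l in S) vs l :|: X
    = (vs i :|: Q) :|: (\bigcup_(l in S :\ i) vs l :|: X :\: Q).
  have {1}-> : X = Q :|: X :\: Q by rewrite -{1}(setID X Q) (setIidPr qX).
  by rewrite (big_setD1 i) //= setUACA.
apply: tiledUU; first exact: Hab.
- apply: IH.
  + by rewrite cardsD (setIidPr qX) cX /Q card_imset // cardsT mulSn addKn.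
  + by apply: disjointWl dXU; exact: subsetDl.
  + by move=> l /setD1P[_ /tS].
  + by move=> l l' /setD1P[_ lS] /setD1P[_ lS']; apply: dS.
  + move=> q'; have := abS q'; rewrite setIDA.
    rewrite (cardsD1 i (ab q' :&: S)); case: (_ \in _) => //=.
    by rewrite add0n => /ltnW.
- rewrite -setI_eq0 setIUl !setIUr !setU_eq0 !setI_eq0 dSi /=.
  rewrite (disjointWl qX dXU) disjoint_sym (disjointWl _ dXi) ?subsetDl //=.
  by rewrite -setI_eq0 setIDA setIC setDE -setIA setICr setI0.
Qed.

Lemma exists_almost_tiling (W V : finType) (EF : {set {set W}}) (EH : {set {set V}})
    (r : nat) (Z : {set V}) : (0 < #|W|)%N ->
  (forall X : {set V}, (r < #|X|)%N -> exists B : {set V}, B \subset X /\ copy_on EF EH B) ->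
  exists A : {set V}, [/\ A \subset Z, tiled EF EH A & (#|Z :\: A| <= r)%N].
Proof.
move=> W0 H; have [n] := ubnP #|Z|; elim: n Z => // n IH Z leZ.
have [Zr|Zr] := leqP #|Z| r.
  by exists set0; rewrite sub0set setD0; split => //; exact: tiled0.
have [B [BZ cB]] := H Z Zr.
have B0 : (0 < #|B|)%N.
  by case: cB => phi [pinj [<- _]]; rewrite card_imset // cardsT.
have [|A [AZ tA cA]] := IH (Z :\: B).
  have := cardsD Z B; rewrite (setIidPr BZ); have := subset_leq_card BZ; lia.
exists (B :|: A); split.
- by rewrite subUset BZ (subset_trans AZ) // subsetDl.
- apply: tiledU => //; rewrite disjoint_sym disjoints_subset.
  by apply: subset_trans AZ _; rewrite setDE subsetIr.
- by rewrite -setDDl.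
Qed.

(** The homomorphisms into [X] have order n^|W| and so outnumber the non-injective maps, of which
    there are at most |W|^2 n^(|W|-1). *)
Lemma exists_copy_within (R : realType) (k : nat) (W V : finType) (EF : {set {set W}})
    (EH : {set {set V}}) (c : W -> 'I_k) (p mu eta : R) (X : {set V}) :
  (0 < k)%N -> (0 < #|W|)%N -> (0 < #|V|)%N -> kcoloring EF c ->
  edge_dense k EH p mu -> 0 <= p -> 0 <= eta ->
  eta * #|V|%:R <= #|X|%:R -> mu <= p * eta ^+ k / 2 ->
  #|W|%:R ^+ 2 < (p * eta ^+ k / 2) ^+ (2 ^ #|W|) * #|V|%:R ->
  exists B : {set V}, B \subset X /\ copy_on EF EH B.
Proof.
move=> k0 W0 V0 Hc dE p0 e0 eX Hmu big.
have := card_hom_within k0 W0 V0 Hc dE p0 e0 eX Hmu.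
set d := _ ^+ (2 ^ _) in big *; set P := [set phi | _] => dP.
have := card_ffun_bad R W (set0 : {set V}) V0; rewrite cards0 mulr0 addr0.
set Bad := [set phi | _] => cB.
have n0 : 0 < #|V|%:R :> R by rewrite ltr0n.
have : (#|Bad| < #|P|)%N.
  rewrite -(ltr_nat R) -(ltr_pM2l n0); apply: le_lt_trans cB _.
  apply: lt_le_trans (ler_wpM2l (ltW n0) dP).
  by rewrite mulrCA mulrA ltr_pM2r ?exprn_gt0.
move=> PB; have /subsetPn[phi] : ~~ (P \subset Bad).
  by apply: contraTN PB => /subset_leq_card; rewrite -leqNgt.
rewrite !inE negb_or negbK => /andP[/forall_inP hphi /forallP phiX] /andP[/injectiveP phi_inj _].
exists (phi @: [set: W]); split; first by apply/subsetP => _ /imsetP[w _ ->].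
by exists phi; split => //; split.
Qed.

Lemma has_factor_of_constants (R : realType) (k : nat) (W V : finType)
    (EF : {set {set W}}) (EH : {set {set V}}) (c : W -> 'I_k) (p a mu beta : R)
    (w0 : W) (L K : nat) :
  (0 < k)%N -> (0 < #|V|)%N -> kcoloring EF c -> is_kgraph k EH ->
  edge_dense k EH p mu -> min_codeg1_ge k EH a ->
  0 < p -> 0 < a -> mu <= p / 2 -> mu <= p ^+ 2 * a / 4 ->
  #|W|%:R * (2 * mu / (p * a)) <= (p / 2) ^+ (2 ^ #|W|) / 2 ->
  mu <= p * K%:R^-1 ^+ k / 2 ->
  (p / 2) ^+ (2 ^ #|W|) / 2 * (p ^+ 2 * a / 4) ^+ (2 ^ #|W| * #|W|) = 2 * beta ->
  0 < beta -> beta <= 1 -> (1 - beta / 2) ^+ L <= 4^-1 -> (0 < K)%N ->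
  #|{: option W * W}|%:R ^+ 2 * L%:R <= beta / 2 * K%:R ->
  #|{: option W * W}|%:R ^+ 2 + #|{: option W * W}|%:R * #|W|%:R <= beta / 2 * #|V|%:R ->
  (#|V| ^ #|W| < 2 ^ (#|V| %/ K))%N ->
  #|W|%:R ^+ 2 < (p * K%:R^-1 ^+ k / 2) ^+ (2 ^ #|W|) * #|V|%:R ->
  (#|W| %| #|V|)%N -> has_factor EF EH.
Proof.
move=> k0 V0 Hc kH dE dH p0 a0 mu1 mu2 mu3 mu4 beta_def b0 b1 rhoL K0.
set m := #|{: option W * W}| => mLK mV powV big dvd.
have W0 : (0 < #|W|)%N by apply/card_gt0P; exists w0.
set n : R := #|V|%:R in mV big; have n0 : 0 < n by rewrite ltr0n.
set q := (#|V| %/ K)%N in powV.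
have KR : 0 < K%:R :> R by rewrite ltr0n.
have qK : q%:R * K%:R <= n by rewrite -natrM ler_nat leq_trunc_div.
pose ab (j : {ffun W -> V}) := clean_absorbers EF EH w0 j.
have cardI : #|{ffun option W * W -> V}|%:R = n ^+ m by rewrite card_ffun natrX.
(* The greedy choice runs for L q steps, using at most m L q vertices; the choice of K gives m^2 L q
   <= (beta/2) K q <= (beta/2) n. *)
have Hab (j : {ffun W -> V}) (U : {set V}) : (#|U| <= m * (L * q))%N ->
    beta * #|{ffun option W * W -> V}|%:R
      <= #|[set T in ab j | [disjoint absorber_set w0 T & U]]|%:R.
  rewrite -(ler_nat R) !natrM => cU; rewrite cardI.
  have hA := card_absorbers w0 j k0 V0 Hc kH dE dH p0 a0 mu1 mu2 mu3.
  rewrite beta_def in hA.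
  have := card_clean_absorbers (U := U) V0 hA.
  have -> : 2 * beta / 2 = beta by field.
  move=> H.
  apply: le_trans (H _) _.
    have m0 : 0 <= m%:R :> R by [].
    have L0 : 0 <= L%:R :> R by [].
    have q0 : 0 <= q%:R :> R by [].
    have := ler_wpM2l m0 cU; have := ler_wpM2r q0 mLK.
    have := ler_wpM2l (ltW b0) qK; rewrite -/n -/m; nra.
  rewrite ler_nat; apply: subset_leq_card; apply/subsetP => T; rewrite !in_set.
  case/andP => -> /=; apply: disjointWl; exact: absorber_set_sub.
have vsm (T : {ffun option W * W -> V}) : (#|absorber_set w0 T| <= m)%N.
  apply: leq_trans (subset_leq_card (absorber_set_sub w0 T)) _.
  by rewrite /m -cardsT leq_imset_card.
have vs0 (T : {ffun option W * W -> V}) (j : {ffun W -> V}) :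
    T \in ab j -> absorber_set w0 T != set0.
  by move=> _; apply/set0Pn; exists (row_ffun T None w0); rewrite in_setU imset_f.
have /card_gt0P[v0 _] := V0.
have I0 : (0 < #|{ffun option W * W -> V}|)%N by rewrite card_ffun expn_gt0 V0.
have [S [S1 S2 S3]] := greedy_family [ffun=> v0] b0 b1 I0 Hab vsm vs0.
(* Every L steps divide the potential bound by at least 4. A tuple with at most q absorbers would
   give 2^-q <= n^|W| 4^-q, against n^|W| < 2^q. *)
have abS (j : {ffun W -> V}) : (q < #|ab j :&: S|)%N.
  rewrite ltnNge; apply/negP => le_q; have := S3 j; apply/negP; rewrite -ltNge.
  have h1 : (1 - beta / 2) ^+ (L * q) <= 4^-1 ^+ q.
    by rewrite exprM lerXn2r // ?nnegrE ?exprn_ge0 //; lra.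
  have h2 : 2^-1 ^+ q <= 2^-1 ^+ #|ab j :&: S| :> R.
    by apply: ler_wiXn2l => //; lra.
  apply: lt_le_trans h2; apply: le_lt_trans (ler_wpM2l (ler0n _ _) h1) _.
  rewrite card_ffun.
  have -> : 4^-1 = 2^-1 * 2^-1 :> R by lra.
  rewrite exprMn mulrA -[ltRHS]mul1r ltr_pM2r ?exprn_gt0 ?invr_gt0 //.
  by rewrite exprVn ltr_pdivrMr ?exprn_gt0 // mul1r -natrX ltr_nat.
have tS T : T \in S -> tiled EF EH (absorber_set w0 T).
  move=> /S1[j]; rewrite in_set => /andP[Tj /andP[/injectiveP Tinj _]].
  exact: tiled_absorber_set Tj.
set U := \bigcup_(T in S) absorber_set w0 T.
have tU : tiled EF EH U by apply: tiled_bigcup.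
have Hcopy (X : {set V}) : (q < #|X|)%N -> exists B : {set V}, B \subset X /\ copy_on EF EH B.
  move=> qX; apply: (exists_copy_within k0 W0 V0 Hc dE (ltW p0) _ _ mu4 big).
    by rewrite invr_ge0.
  rewrite mulrC ler_pdivrMr // -natrM ler_nat ltnW //.
  by apply: leq_trans (ltn_ceil #|V| K0) _; rewrite leq_mul2r qX orbT.
have [A [AU tA cA]] := exists_almost_tiling (~: U) W0 Hcopy.
set X := ~: U :\: A in cA.
have dAU : [disjoint A & U] by rewrite disjoints_subset.
have dX : [disjoint X & U] by rewrite disjoints_subset subsetDl.
have dAX : [disjoint A & U :|: X].
  by rewrite disjoints_subset setCU subsetI AU /= setCD subsetUr.
have splitV : [set: V] = A :|: (U :|: X).
  by apply/setP => v; rewrite !inE; case: (v \in A); case: (v \in U).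
(* Both [A] and [U] are tiled, so their sizes are multiples of |W|, and the leftover inherits
   divisibility from |V|. *)
have fX : (#|W| %| #|X|)%N.
  have := dvd; rewrite -[#|V|]cardsT splitV cardsU (disjoint_setI0 dAX) cards0 subn0.
  rewrite dvdn_addr ?(tiled_dvdn tA) // cardsU setIC (disjoint_setI0 dX) cards0 subn0.
  by rewrite dvdn_addr ?(tiled_dvdn tU).
suff tV : tiled EF EH [set: V] by have [P HP] := tiled_partition W0 tV; exists P.
rewrite splitV; apply: tiledUU => //.
apply: (@absorb _ _ _ EF EH ab _ (#|X| %/ #|W|)) => //; last 2 first.
- by rewrite divnK.
- move=> j; apply: leq_trans (ltnW (abS j)); exact: leq_trans (leq_div _ _) cA.
move=> j T jinj; rewrite in_set => /andP[Tj /andP[/injectiveP Tinj dT]].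
exact: tiled_absorber_setU.
Qed.

Theorem mainTheorem4 (R : realType) (k : nat) (W : finType) (EF : {set {set W}}) :
  (2 <= k)%N -> is_kgraph k EF -> kpartite k EF -> in_FACTOR_edge1 R k EF.
Proof.
move=> k2 _ [c Hc] p a /andP[p0 p1] /andP[a0 a1].
(* If F has no vertices, divisibility forces |V| = 0, which the threshold 1 excludes. *)
have [W0|W0] := posnP #|W|.
  exists 1%N, 1 => // V EH _ _ _ V1; rewrite W0 dvd0n => /eqP V0.
  by rewrite V0 in V1.
have /card_gt0P[w0 _] := W0.
set m := #|{: option W * W}|.
pose c1 : R := (p / 2) ^+ (2 ^ #|W|) / 2.
pose c2 : R := (p ^+ 2 * a / 4) ^+ (2 ^ #|W| * #|W|).
pose beta := c1 * c2 / 2.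
have pa0 : 0 < p ^+ 2 * a / 4 by rewrite divr_gt0 // mulr_gt0 // exprn_gt0.
have pa1 : p ^+ 2 * a / 4 <= 1 by nra.
have c10 : 0 < c1 by rewrite !(divr_gt0, exprn_gt0).
have c20 : 0 < c2 by rewrite exprn_gt0.
have c11 : c1 <= 1.
  have : (p / 2) ^+ (2 ^ #|W|) <= 1 by rewrite exprn_ile1 //; lra.
  rewrite /c1; lra.
have c21 : c2 <= 1 by rewrite exprn_ile1 // ltW.
have b0 : 0 < beta by rewrite divr_gt0 // mulr_gt0.
have b1 : beta <= 1 by rewrite /beta; nra.
have [L HL] : exists L : nat, (1 - beta / 2) ^+ L <= 4^-1.
  by apply: exists_expr_le_quarter; lra.
pose K := (Num.bound (m%:R ^+ 2 * L%:R / (beta / 2))).+1.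
have b2 : 0 < beta / 2 by lra.
have HK : m%:R ^+ 2 * L%:R <= beta / 2 * K%:R.
  rewrite [leRHS]mulrC -ler_pdivrMr //.
  apply: le_trans (ltW (archi_boundP _)) _; last by rewrite ler_nat leqnSn.
  by rewrite divr_ge0 ?(ltW b2) // mulr_ge0 // exprn_ge0.
pose d := (p * K%:R^-1 ^+ k / 2) ^+ (2 ^ #|W|).
have d0' : 0 < p * K%:R^-1 ^+ k / 2 by rewrite divr_gt0 // mulr_gt0 // exprn_gt0 // invr_gt0.
have d0 : 0 < d by rewrite exprn_gt0.
have [n2 Hn2] := expn_lt_exp2_divn W0 (isT : (0 < K)%N).
pose x1 := (m%:R ^+ 2 + m%:R * #|W|%:R) / (beta / 2).
pose x3 := #|W|%:R ^+ 2 / d.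
(* The four bounds serve, in order, the copies D in the whole vertex set, the link switches, the
   copies inside sets of at least n/K vertices, and the scarcity of poor partners. *)
pose mu := Num.min (Num.min (p / 2) (p ^+ 2 * a / 4))
  (Num.min (p * K%:R^-1 ^+ k / 2) (c1 * (p * a) / (2 * #|W|%:R))).
have WR : 0 < #|W|%:R :> R by rewrite ltr0n.
(* Here [n2] makes n^|W| < 2^(n %/ K), [x1] makes unclean absorbers negligible, and [x3] makes
   non-injective homomorphisms negligible. *)
exists (maxn 1 (maxn n2 (maxn (Num.bound x1) (Num.bound x3)))); exists mu.
  have x40 : 0 < c1 * (p * a) / (2 * #|W|%:R).
    by apply: divr_gt0; apply: mulr_gt0 => //; exact: mulr_gt0.
  by rewrite /mu !lt_min pa0 d0' x40 divr_gt0.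
move=> V EH kH dE dH; rewrite !geq_max => /and4P[V0 Vn2 Vx1 Vx3] dvd.
have bound_le x : 0 <= x -> (Num.bound x <= #|V|)%N -> x < #|V|%:R.
  by move=> x0 xV; apply: lt_le_trans (archi_boundP x0) _; rewrite ler_nat.
apply: (has_factor_of_constants w0 (ltnW k2) V0 Hc kH dE dH p0 a0 (beta := beta) (L := L) (K := K)) => //.
- by rewrite /mu !ge_min lexx.
- by rewrite /mu !ge_min lexx orbT.
- have : mu <= c1 * (p * a) / (2 * #|W|%:R) by rewrite /mu !ge_min lexx !orbT.
  rewrite ler_pdivlMr ?mulr_gt0 // => h.
  by rewrite -/c1 mulrA ler_pdivrMr ?mulr_gt0 //; lra.
- by rewrite /mu !ge_min lexx !orbT.
- by rewrite -/c1 -/c2 /beta; field.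
- rewrite [leRHS]mulrC -ler_pdivrMr //; apply/ltW/bound_le => //.
  by rewrite divr_ge0 ?(ltW b2) // addr_ge0 ?mulr_ge0 ?exprn_ge0.
- exact: Hn2.
- rewrite [ltRHS]mulrC -ltr_pdivrMr // bound_le //.
  by rewrite divr_ge0 ?exprn_ge0 // ltW.
Qed.
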